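(* Let $(!, \delta, \varepsilon, \partial)$ be a Cartesian differential comonad on a category $\mathbb{X}$ with finite biproducts. Then the coKleisli category $\mathbb{X}_!$, with its canonical Cartesian left additive structure, is a Cartesian differential category whose differential combinator $\mathsf{D}$ is defined as follows: for a coKleisli map $[\![ f ]\!] : !(A) \to B$, its derivative $[\![ \mathsf{D}[f] ]\!] : !(A \times A) \to B$ is $$[\![ \mathsf{D}[f] ]\!] := [\![ f ]\!] \circ \partial_A .$$ Furthermore: (i) For every object $A$ of $\mathbb{X}$, $[\![ \mathsf{D}[\varphi_A] ]\!] = \partial_A$. (ii) A coKleisli map $[\![ f ]\!] : !(A) \to B$ is $\mathsf{D}$-linear in $\mathbb{X}_!$ if and only if $[\![ f ]\!] \circ \partial_A \circ !(\iota_1) = [\![ f ]\!]$. (iii) For every map $f : A \to B$ in $\mathbb{X}$, $[\![ \mathsf{F}_!(f) ]\!]$ is $\mathsf{D}$-linear in $\mathbb{X}_!$. (iv) There is a functor $\mathsf{F}_{\mathsf{D}\text{-}\mathsf{lin}} : \mathbb{X} \to \mathsf{D}\text{-}\mathsf{lin}[\mathbb{X}_!]$ defined on objects by $\mathsf{F}_{\mathsf{D}\text{-}\mathsf{lin}}(A) = A$ and on maps $f : A \to B$ by $[\![ \mathsf{F}_{\mathsf{D}\text{-}\mathsf{lin}}(f) ]\!] = f \circ \varepsilon_A = [\![ \mathsf{F}_!(f) ]\!]$, and $\mathsf{U} \circ \mathsf{F}_{\mathsf{D}\text{-}\mathsf{lin}} = \mathsf{F}_!$, where $\mathsf{U}: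 \mathsf{D}\text{-}\mathsf{lin}[\mathbb{X}_!] \to \mathbb{X}_!$ is the forgetful functor.
   Context: Composition is in classical order: $g \circ f$ means first $f$, then $g$. In a category with (chosen) finite products, $\pi_0,\pi_1$ are the projections of $A\times B$, $\langle f,g\rangle$ is pairing, $h\times k=\langle h\circ\pi_0,k\circ\pi_1\rangle$, and $\top$ is the terminal object. Cartesian left additive categories. A left additive category is a category whose hom-sets are commutative monoids (with $+$ and $0$) such that $(f+g)\circ x=f\circ x+g\circ x$ and $0\circ x=0$. A map $f$ is additive if $f\circ(x+y)=f\circ x+f\circ y$ and $f\circ 0=0$. A Cartesian left additive category is a left additive category with finite products in which all projections are additive. A category with finite biproducts is regarded as a Cartesian left additive category (in which every map is additive). In a Cartesian left additive category define $\iota_0=\langle 1_A,0\rangle: A\to A\times B$, $\iota_1=\langle 0,1_B\rangle: B\to A\times B$, $\nabla_A=\pi_0+\pi_1: A\times A\to A$, $\ell_A=\iota_0\times\iota_1: A\times A\to (A\times A)\times(A\times A)$, $c_A=\langle\pi_0\times\pi_0,\pi_1\times\pi_1\rangle:(A\times A)\times(A\times A)\to(A\times A)\times(A\times A)$. Cartesian differential categories. A differential combinator on a Cartesian left additive category is a family of operators sending $f:A\to B$ to $\mathsf{D}[f]:A\times A\to B$ with: [CD.1] $\mathsf{D}[f+g]=\mathsf{D}[f]+\mathsf{D}[g]$, $\mathsf{D}[0]=0$; [CD.2] $\mathsf{D}[f]\circ(1_A\times\nabla_A)=\mathsf{D}[f]\circ(1_A\times\pi_0)+\mathsf{D}[f]\circ(1_A\times\pi_1)$,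 $\mathsf{D}[f]\circ\iota_0=0$; [CD.3] $\mathsf{D}[1_A]=\pi_1$, $\mathsf{D}[\pi_0]=\pi_0\circ\pi_1$, $\mathsf{D}[\pi_1]=\pi_1\circ\pi_1$; [CD.4] $\mathsf{D}[\langle f,g\rangle]=\langle\mathsf{D}[f],\mathsf{D}[g]\rangle$; [CD.5] $\mathsf{D}[g\circ f]=\mathsf{D}[g]\circ\langle f\circ\pi_0,\mathsf{D}[f]\rangle$; [CD.6] $\mathsf{D}[\mathsf{D}[f]]\circ\ell_A=\mathsf{D}[f]$; [CD.7] $\mathsf{D}[\mathsf{D}[f]]\circ c_A=\mathsf{D}[\mathsf{D}[f]]$. A Cartesian differential category is a Cartesian left additive category with a differential combinator. A map $f$ is $\mathsf{D}$-linear if $\mathsf{D}[f]=f\circ\pi_1$. $\mathsf{D}\text{-}\mathsf{lin}[\mathbb{Y}]$ is the subcategory of a Cartesian differential category $\mathbb{Y}$ with the same objects and the $\mathsf{D}$-linear maps. coKleisli categories. For a comonad $(!,\delta,\varepsilon)$ on $\mathbb{X}$ ($\delta_A:!(A)\to !!(A)$, $\varepsilon_A:!(A)\to A$), the coKleisli category $\mathbb{X}_!$ has the objects of $\mathbb{X}$, and a map $f:A\to B$ in $\mathbb{X}_!$ is a map $[\![f]\!]:!(A)\to B$ in $\mathbb{X}$; $[\![g\circ f]\!]=[\![g]\!]\circ !([\![f]\!])\circ\delta_A$ and $[\![1_A]\!]=\varepsilon_A$. Equations between bracketed maps use composition in $\mathbb{X}$ outside brackets and composition in $\mathbb{X}_!$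 inside brackets. The functor $\mathsf{F}_!:\mathbb{X}\to\mathbb{X}_!$ is the identity on objects with $[\![\mathsf{F}_!(f)]\!]=f\circ\varepsilon_A$. The coKleisli map $\varphi_A: A\to !(A)$ is given by $[\![\varphi_A]\!]=1_{!(A)}$. If $\mathbb{X}$ is Cartesian left additive, the canonical Cartesian left additive structure of $\mathbb{X}_!$ is: products on objects and $\top$ as in $\mathbb{X}$, $[\![\pi_j]\!]=\pi_j\circ\varepsilon_{A\times B}$, $[\![\langle f,g\rangle]\!]=\langle[\![f]\!],[\![g]\!]\rangle$, $[\![f+g]\!]=[\![f]\!]+[\![g]\!]$, $[\![0]\!]=0$. Cartesian differential comonads. Let $(!,\delta,\varepsilon)$ be a comonad on a category $\mathbb{X}$ with finite biproducts. A differential combinator transformation is a natural transformation $\partial_A:!(A\times A)\to !(A)$ with: [dc.1] $\partial_A\circ !(\iota_0)=0$; [dc.2] $\partial_A\circ !(1_A\times\nabla_A)=\partial_A\circ(!(1_A\times\pi_0)+!(1_A\times\pi_1))$; [dc.3] $\varepsilon_A\circ\partial_A=\pi_1\circ\varepsilon_{A\times A}$; [dc.4] $\delta_A\circ\partial_A=\partial_{!(A)}\circ !(\langle !(\pi_0),\partial_A\rangle)\circ\delta_{A\times A}$; [dc.5] $\partial_A\circ\partial_{A\times A}\circ !(\ell_A)=\partial_A$; [dc.6] $\partial_A\circ\partial_{A\times A}\circ !(c_A)=\partial_A\circ\partial_{A\times A}$. A Cartesian differential comonad is a quadruple $(!,\delta,\varepsilon,\partial)$ consisting of such a comonad and a differential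 combinator transformation. *)

(* Defs.v *)
From Stdlib Require Import ssreflect ProofIrrelevance.

Set Implicit Arguments.
Unset Strict Implicit.
Unset Printing Implicit Defensive.

Declare Scope cat_scope.
Delimit Scope cat_scope with cat.
Local Open Scope cat_scope.

Reserved Notation "g ∘ f" (at level 40, left associativity).
Reserved Notation "A × B" (at level 40, left associativity).
Reserved Notation "h ⨉ k" (at level 38, no associativity).
Reserved Notation "⟨ f , g ⟩" (at level 0, f at level 99, g at level 99).
Reserved Notation "⟦ f ⟧" (at level 0, f at level 99).

Record category := Category {
  Ob :> Type;
  Hom : Ob -> Ob -> Type;
  idm : forall A, Hom A A;
  comp : forall A B C, Hom B C -> Hom A B -> Hom A C;
  comp1m : forall A B (f : Hom A B), comp (idm B) f = f;
  compm1 : forall A B (f : Hom A B), comp f (idm A) = f;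
  compA : forall A B C E (h : Hom C E) (g : Hom B C) (f : Hom A B),
    comp h (comp g f) = comp (comp h g) f
}.
Arguments Hom {c} A B.
Arguments idm {c} A.
Arguments comp {c A B C} g f.
Notation "g ∘ f" := (comp g f) : cat_scope.

Record is_functor (C E : category) (F : C -> E)
    (Fm : forall A B, Hom A B -> Hom (F A) (F B)) : Prop := IsFunctor {
  is_functor1 : forall A, Fm A A (idm A) = idm (F A);
  is_functorM : forall A B B' (g : Hom B B') (f : Hom A B),
    Fm A B' (g ∘ f) = Fm B B' g ∘ Fm A B f
}.

Record functor (C E : category) := Functor {
  fob :> C -> E;
  fmap : forall A B, Hom A B -> Hom (fob A) (fob B);
  functor_laws : is_functor fmap
}.
Arguments fmap {C E} F {A B} f : rename.

Lemma functor_comp_laws (C E H : category) (G : functor E H) (F : functor C E) :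
  is_functor (F := fun A => G (F A)) (fun A B f => fmap G (@fmap _ _ F A B f)).
Proof.
by case: G F => [? ? [g1 gM]] [? ? [f1 fM]]; split=> /= *; rewrite ?f1 ?fM.
Qed.

Definition functor_comp (C E H : category) (G : functor E H) (F : functor C E) :
  functor C H := Functor (functor_comp_laws G F).

Class FiniteProducts (C : category) := {
  top : C;
  to_top : forall A : C, Hom A top;
  to_top_unique : forall (A : C) (f : Hom A top), f = to_top A;
  cprod : C -> C -> C;
  cproj0 : forall A B, Hom (cprod A B) A;
  cproj1 : forall A B, Hom (cprod A B) B;
  cpair : forall X A B, Hom X A -> Hom X B -> Hom X (cprod A B);
  proj0_pair : forall X A B (f : Hom X A) (g : Hom X B),
    cproj0 A B ∘ cpair f g = f;
  proj1_pair : forall X A B (f : Hom X A) (g : Hom X B),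
    cproj1 A B ∘ cpair f g = g;
  pair_unique : forall X A B (f : Hom X A) (g : Hom X B) (h : Hom X (cprod A B)),
    cproj0 A B ∘ h = f -> cproj1 A B ∘ h = g -> h = cpair f g
}.
(** Without a mode on each structure class, resolution through [cokl_cla] loops when the category is an evar. *)
#[global] Hint Mode FiniteProducts ! : typeclass_instances.
Arguments cproj0 {C _ A B}.
Arguments cproj1 {C _ A B}.
Arguments cpair {C _ X A B} f g.
Notation "A × B" := (cprod A B) : cat_scope.
Notation "'π0'" := cproj0 : cat_scope.
Notation "'π1'" := cproj1 : cat_scope.
Notation "⟨ f , g ⟩" := (cpair f g) : cat_scope.
Notation "h ⨉ k" := (cpair (h ∘ cproj0) (k ∘ cproj1)) : cat_scope.

Class LeftAdditive (C : category) := {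
  madd : forall A B : C, Hom A B -> Hom A B -> Hom A B;
  mzero : forall A B : C, Hom A B;
  maddA : forall A B (f g h : Hom A B), madd f (madd g h) = madd (madd f g) h;
  maddC : forall A B (f g : Hom A B), madd f g = madd g f;
  madd0 : forall A B (f : Hom A B), madd (mzero A B) f = f;
  madd_compl : forall A B B' (f g : Hom B B') (x : Hom A B),
    madd f g ∘ x = madd (f ∘ x) (g ∘ x);
  mzero_compl : forall A B B' (x : Hom A B), mzero B B' ∘ x = mzero A B'
}.
#[global] Hint Mode LeftAdditive ! : typeclass_instances.
Arguments madd {C _ A B} f g.
Arguments mzero {C _ A B}.
Notation "f + g" := (madd f g) : cat_scope.
Notation "0" := mzero : cat_scope.

Definition additive (C : category) (L : LeftAdditive C) (A B : C)
    (f : Hom A B) : Prop :=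
  (forall (X : C) (x y : Hom X A), f ∘ (x + y) = f ∘ x + f ∘ y) /\
  (forall X : C, f ∘ (0 : Hom X A) = 0).

Class CartesianLeftAdditive (C : category) := {
  cla_products :: FiniteProducts C;
  cla_additive :: LeftAdditive C;
  proj0_additive : forall A B : C, additive _ (π0 : Hom (A × B) A);
  proj1_additive : forall A B : C, additive _ (π1 : Hom (A × B) B)
}.
#[global] Hint Mode CartesianLeftAdditive ! : typeclass_instances.

Definition inj0 (C : category) {L : CartesianLeftAdditive C} (A B : C) :
  Hom A (A × B) := ⟨idm A, 0⟩.
Definition inj1 (C : category) {L : CartesianLeftAdditive C} (A B : C) :
  Hom B (A × B) := ⟨0, idm B⟩.
Definition codiag (C : category) {L : CartesianLeftAdditive C} (A : C) :
  Hom (A × A) A := π0 + π1.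
Arguments inj0 {C L A B}.
Arguments inj1 {C L A B}.
Notation "'ι0'" := inj0 : cat_scope.
Notation "'ι1'" := inj1 : cat_scope.
Notation "∇" := codiag : cat_scope.

Definition ell (C : category) {L : CartesianLeftAdditive C} (A : C) :
  Hom (A × A) ((A × A) × (A × A)) := ι0 ⨉ ι1.
Definition interchange (C : category) {L : CartesianLeftAdditive C} (A : C) :
  Hom ((A × A) × (A × A)) ((A × A) × (A × A)) := ⟨π0 ⨉ π0, π1 ⨉ π1⟩.

(** A zero object together with, for all [A] and [B], an object that is both
    a product and a coproduct of [A] and [B], whose projections and injections
    satisfy the usual orthogonality equations.  No addition of maps is assumed:
    it is derived below from the biproducts. *)
Class FiniteBiproducts (C : category) := {
  zobj : C;
  to_zobj : forall A : C, Hom A zobj;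
  to_zobj_unique : forall (A : C) (f : Hom A zobj), f = to_zobj A;
  from_zobj : forall A : C, Hom zobj A;
  from_zobj_unique : forall (A : C) (f : Hom zobj A), f = from_zobj A;
  biprod : C -> C -> C;
  bproj0 : forall A B, Hom (biprod A B) A;
  bproj1 : forall A B, Hom (biprod A B) B;
  binj0 : forall A B, Hom A (biprod A B);
  binj1 : forall A B, Hom B (biprod A B);
  bpair : forall X A B, Hom X A -> Hom X B -> Hom X (biprod A B);
  bproj0_pair : forall X A B (f : Hom X A) (g : Hom X B),
    bproj0 A B ∘ bpair f g = f;
  bproj1_pair : forall X A B (f : Hom X A) (g : Hom X B),
    bproj1 A B ∘ bpair f g = g;
  bpair_unique : forall X A B (f : Hom X A) (g : Hom X B)
      (h : Hom X (biprod A B)),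
    bproj0 A B ∘ h = f -> bproj1 A B ∘ h = g -> h = bpair f g;
  bcopair : forall X A B, Hom A X -> Hom B X -> Hom (biprod A B) X;
  bcopair_inj0 : forall X A B (f : Hom A X) (g : Hom B X),
    bcopair f g ∘ binj0 A B = f;
  bcopair_inj1 : forall X A B (f : Hom A X) (g : Hom B X),
    bcopair f g ∘ binj1 A B = g;
  bcopair_unique : forall X A B (f : Hom A X) (g : Hom B X)
      (h : Hom (biprod A B) X),
    h ∘ binj0 A B = f -> h ∘ binj1 A B = g -> h = bcopair f g;
  bproj0_inj0 : forall A B, bproj0 A B ∘ binj0 A B = idm A;
  bproj1_inj1 : forall A B, bproj1 A B ∘ binj1 A B = idm B;
  bproj1_inj0 : forall A B, bproj1 A B ∘ binj0 A B = from_zobj B ∘ to_zobj A;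
  bproj0_inj1 : forall A B, bproj0 A B ∘ binj1 A B = from_zobj A ∘ to_zobj B
}.

Section BiproductsAdditive.
Context (C : category) {H : FiniteBiproducts C}.

Definition bip_products : FiniteProducts C := {|
  to_top_unique := to_zobj_unique;
  proj0_pair := bproj0_pair;
  proj1_pair := bproj1_pair;
  pair_unique := bpair_unique
|}.

Definition bip_zero (A B : C) : Hom A B := from_zobj B ∘ to_zobj A.
Definition bip_add (A B : C) (f g : Hom A B) : Hom A B :=
  bcopair (idm B) (idm B) ∘ bpair f g.

Lemma bip_zero_compl A B B' (x : Hom A B) : bip_zero B B' ∘ x = bip_zero A B'.
Proof. by rewrite /bip_zero -compA (to_zobj_unique (_ ∘ x)). Qed.

Lemma bip_zero_compr A B B' (x : Hom B B') : x ∘ bip_zero A B = bip_zero A B'.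
Proof. by rewrite /bip_zero compA (from_zobj_unique (x ∘ _)). Qed.

Lemma bpair_compl X Y A B (f : Hom X A) (g : Hom X B) (x : Hom Y X) :
  bpair f g ∘ x = bpair (f ∘ x) (g ∘ x).
Proof. by apply: bpair_unique; rewrite compA ?bproj0_pair ?bproj1_pair. Qed.

Lemma bip_add_compl A B B' (f g : Hom B B') (x : Hom A B) :
  bip_add f g ∘ x = bip_add (f ∘ x) (g ∘ x).
Proof. by rewrite /bip_add -compA bpair_compl. Qed.

Lemma bip_pair0r A B B' (f : Hom A B) :
  bpair f (bip_zero A B') = binj0 B B' ∘ f.
Proof.
symmetry; apply: bpair_unique; rewrite compA.
  by rewrite bproj0_inj0 comp1m.
by rewrite bproj1_inj0 -/(bip_zero B B') bip_zero_compl.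
Qed.

Lemma bip_pair0l A B B' (f : Hom A B') :
  bpair (bip_zero A B) f = binj1 B B' ∘ f.
Proof.
symmetry; apply: bpair_unique; rewrite compA.
  by rewrite bproj0_inj1 -/(bip_zero B' B) bip_zero_compl.
by rewrite bproj1_inj1 comp1m.
Qed.

Lemma bip_add0 A B (f : Hom A B) : bip_add (bip_zero A B) f = f.
Proof. by rewrite /bip_add bip_pair0l compA bcopair_inj1 comp1m. Qed.

Lemma bip_addr0 A B (f : Hom A B) : bip_add f (bip_zero A B) = f.
Proof. by rewrite /bip_add bip_pair0r compA bcopair_inj0 comp1m. Qed.

Lemma bip_add_compr A B B' (h : Hom B B') (f g : Hom A B) :
  h ∘ bip_add f g = bip_add (h ∘ f) (h ∘ g).
Proof.
have E : h ∘ bcopair (idm B) (idm B) = bcopair h h.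
  by apply: bcopair_unique; rewrite -compA ?bcopair_inj0 ?bcopair_inj1 compm1.
have E' : bcopair (idm B') (idm B') ∘
    bpair (h ∘ bproj0 B B) (h ∘ bproj1 B B) = bcopair h h.
  apply: bcopair_unique; rewrite -compA bpair_compl -!compA.
    by rewrite bproj0_inj0 bproj1_inj0 -/(bip_zero B B) compm1 bip_zero_compr
      -/(bip_add _ _) bip_addr0.
  by rewrite bproj1_inj1 bproj0_inj1 -/(bip_zero B B) compm1 bip_zero_compr
      -/(bip_add _ _) bip_add0.
by rewrite /bip_add compA E -E' -compA bpair_compl -!compA bproj0_pair
  bproj1_pair.
Qed.

Lemma bip_add_pair X A B (f f' : Hom X A) (g g' : Hom X B) :
  bip_add (bpair f g) (bpair f' g') = bpair (bip_add f f') (bip_add g g').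
Proof.
by apply: bpair_unique; rewrite bip_add_compr ?bproj0_pair ?bproj1_pair.
Qed.

Lemma bip_add_interchange A B (f g f' g' : Hom A B) :
  bip_add (bip_add f g) (bip_add f' g') = bip_add (bip_add f f') (bip_add g g').
Proof. by rewrite {2}/bip_add {3}/bip_add -bip_add_compr bip_add_pair. Qed.

Lemma bip_addC A B (f g : Hom A B) : bip_add f g = bip_add g f.
Proof.
have := bip_add_interchange (bip_zero A B) f g (bip_zero A B).
by rewrite !bip_add0 !bip_addr0.
Qed.

Lemma bip_addA A B (f g h : Hom A B) :
  bip_add f (bip_add g h) = bip_add (bip_add f g) h.
Proof.
have := bip_add_interchange f (bip_zero A B) g h.
by rewrite bip_addr0 bip_add0.
Qed.

Definition bip_left_additive : LeftAdditive C := {|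
  maddA := bip_addA;
  maddC := bip_addC;
  madd0 := bip_add0;
  madd_compl := bip_add_compl;
  mzero_compl := bip_zero_compl
|}.

Lemma bip_additive A B (f : Hom A B) : additive bip_left_additive f.
Proof.
by split=> [X x y|X]; [apply: bip_add_compr | apply: bip_zero_compr].
Qed.

#[global] Instance bip_cla : CartesianLeftAdditive C := {|
  cla_products := bip_products;
  cla_additive := bip_left_additive;
  proj0_additive := fun _ _ => bip_additive _;
  proj1_additive := fun _ _ => bip_additive _
|}.

End BiproductsAdditive.

Record differential_combinator (C : category) {L : CartesianLeftAdditive C} :=
  DifferentialCombinator {
  diff : forall A B : C, Hom A B -> Hom (A × A) B;
  CD1_add : forall A B (f g : Hom A B), diff (f + g) = diff f + diff g;
  CD1_zero : forall A B : C, diff (0 : Hom A B) = 0;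
  CD2_add : forall A B (f : Hom A B),
    diff f ∘ (idm A ⨉ ∇ A) = diff f ∘ (idm A ⨉ π0) + diff f ∘ (idm A ⨉ π1);
  CD2_zero : forall A B (f : Hom A B), diff f ∘ ι0 = 0;
  CD3_id : forall A : C, diff (idm A) = π1;
  CD3_proj0 : forall A B : C, diff (π0 : Hom (A × B) A) = π0 ∘ π1;
  CD3_proj1 : forall A B : C, diff (π1 : Hom (A × B) B) = π1 ∘ π1;
  CD4 : forall X A B (f : Hom X A) (g : Hom X B),
    diff ⟨f, g⟩ = ⟨diff f, diff g⟩;
  CD5 : forall A B B' (g : Hom B B') (f : Hom A B),
    diff (g ∘ f) = diff g ∘ ⟨f ∘ π0, diff f⟩;
  CD6 : forall A B (f : Hom A B), diff (diff f) ∘ ell A = diff f;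
  CD7 : forall A B (f : Hom A B),
    diff (diff f) ∘ interchange A = diff (diff f)
}.
Arguments differential_combinator C {L}.
Arguments diff {C L} D {A B} f : rename.

Section DLinear.
Context (C : category) {L : CartesianLeftAdditive C}.
Variable D : differential_combinator C.

Definition Dlinear (A B : C) (f : Hom A B) : Prop := diff D f = f ∘ π1.

Lemma Dlinear_id A : Dlinear (idm A).
Proof. by rewrite /Dlinear CD3_id comp1m. Qed.

Lemma Dlinear_comp A B B' (g : Hom B B') (f : Hom A B) :
  Dlinear g -> Dlinear f -> Dlinear (g ∘ f).
Proof.
by rewrite /Dlinear CD5 => -> ->; rewrite -compA proj1_pair compA.
Qed.

Definition Dlin_hom (A B : C) : Type := {f : Hom A B | Dlinear f}.
Definition Dlin_id A : Dlin_hom A A := exist _ (idm A) (Dlinear_id A).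
Definition Dlin_comp A B B' (g : Dlin_hom B B') (f : Dlin_hom A B) :
    Dlin_hom A B' :=
  exist _ (proj1_sig g ∘ proj1_sig f)
    (Dlinear_comp (proj2_sig g) (proj2_sig f)).

Lemma Dlin_hom_eq A B (f g : Dlin_hom A B) : proj1_sig f = proj1_sig g -> f = g.
Proof. by apply: eq_sig_hprop => x p q; apply: proof_irrelevance. Qed.

Lemma Dlin_comp1m A B (f : Dlin_hom A B) : Dlin_comp (Dlin_id B) f = f.
Proof. by apply: Dlin_hom_eq; apply: comp1m. Qed.

Lemma Dlin_compm1 A B (f : Dlin_hom A B) : Dlin_comp f (Dlin_id A) = f.
Proof. by apply: Dlin_hom_eq; apply: compm1. Qed.

Lemma Dlin_compA A B B' E (h : Dlin_hom B' E) (g : Dlin_hom B B')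
    (f : Dlin_hom A B) :
  Dlin_comp h (Dlin_comp g f) = Dlin_comp (Dlin_comp h g) f.
Proof. by apply: Dlin_hom_eq; apply: compA. Qed.

Definition Dlin : category := Category Dlin_comp1m Dlin_compm1 Dlin_compA.

Lemma Dlin_forget_laws :
  is_functor (C := Dlin) (E := C) (F := fun A => A)
    (fun A B (f : Dlin_hom A B) => proj1_sig f).
Proof. by split. Qed.

Definition Dlin_forget : functor Dlin C := Functor Dlin_forget_laws.

End DLinear.

Record comonad (X : category) := Comonad {
  cofunctor :> functor X X;
  delta : forall A, Hom (cofunctor A) (cofunctor (cofunctor A));
  epsilon : forall A, Hom (cofunctor A) A;
  delta_natural : forall A B (f : Hom A B),
    delta B ∘ fmap cofunctor f = fmap cofunctor (fmap cofunctor f) ∘ delta A;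
  epsilon_natural : forall A B (f : Hom A B),
    epsilon B ∘ fmap cofunctor f = f ∘ epsilon A;
  epsilon_delta : forall A, epsilon (cofunctor A) ∘ delta A = idm (cofunctor A);
  fmap_epsilon_delta : forall A,
    fmap cofunctor (epsilon A) ∘ delta A = idm (cofunctor A);
  delta_delta : forall A,
    delta (cofunctor A) ∘ delta A = fmap cofunctor (delta A) ∘ delta A
}.
Arguments delta {X} T A : rename.
Arguments epsilon {X} T A : rename.

Section CoKleisli.
Context (X : category) (T : comonad X).

Definition cokl_hom (A B : X) : Type := Hom (T A) B.
Definition cokl_comp (A B B' : X) (g : cokl_hom B B') (f : cokl_hom A B) :
  cokl_hom A B' := (g : Hom (T B) B') ∘ fmap T (f : Hom (T A) B) ∘ delta T A.

Lemma cokl_comp1m A B (f : cokl_hom A B) : cokl_comp (epsilon T B) f = f.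
Proof.
by rewrite /cokl_comp epsilon_natural -compA epsilon_delta compm1.
Qed.

Lemma cokl_compm1 A B (f : cokl_hom A B) : cokl_comp f (epsilon T A) = f.
Proof. by rewrite /cokl_comp -compA fmap_epsilon_delta compm1. Qed.

Lemma cokl_compA A B B' E (h : cokl_hom B' E) (g : cokl_hom B B')
    (f : cokl_hom A B) :
  cokl_comp h (cokl_comp g f) = cokl_comp (cokl_comp h g) f.
Proof.
rewrite /cokl_comp !(is_functorM (functor_laws T)) -!compA.
do 2 congr (_ ∘ _).
by rewrite !compA delta_natural -!compA delta_delta.
Qed.

Definition coKleisli : category := Category cokl_comp1m cokl_compm1 cokl_compA.

(** Identity function: it only moves a map from the coKleisli category to the
    base category, so that [∘] outside of it is composition in [X]. *)
Definition bracket (A B : coKleisli) (f : Hom A B) : Hom (T A : X) (B : X) := f.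

Definition cokl_phi (A : coKleisli) : Hom A (T A : coKleisli) := idm (T A : X).

Lemma cokl_functor_laws :
  is_functor (C := X) (E := coKleisli) (F := fun A => A)
    (fun A B (f : Hom A B) => f ∘ epsilon T A).
Proof.
split=> [A|A B B' g f] /=; first by rewrite comp1m.
rewrite /cokl_comp (is_functorM (functor_laws T)) -!compA.
by rewrite fmap_epsilon_delta compm1 epsilon_natural.
Qed.

Definition cokl_functor : functor X coKleisli := Functor cokl_functor_laws.

Section CoKleisliCLA.
Context {L : CartesianLeftAdditive X}.

Definition cokl_pair (Y A B : X) (f : cokl_hom Y A) (g : cokl_hom Y B) :
  cokl_hom Y (A × B) := ⟨(f : Hom (T Y) A), (g : Hom (T Y) B)⟩.
Definition cokl_proj0 (A B : X) : cokl_hom (A × B) A := π0 ∘ epsilon T (A × B).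
Definition cokl_proj1 (A B : X) : cokl_hom (A × B) B := π1 ∘ epsilon T (A × B).

Lemma cokl_projE Y A (B : X) (p : Hom B A) (f : cokl_hom Y B) :
  cokl_comp (p ∘ epsilon T B) f = p ∘ f.
Proof.
by rewrite /cokl_comp -!compA (compA (epsilon T B)) epsilon_natural -compA
  epsilon_delta compm1.
Qed.

Lemma cokl_proj0_pair Y A B (f : cokl_hom Y A) (g : cokl_hom Y B) :
  cokl_comp (cokl_proj0 A B) (cokl_pair f g) = f.
Proof. by rewrite cokl_projE; apply: proj0_pair. Qed.

Lemma cokl_proj1_pair Y A B (f : cokl_hom Y A) (g : cokl_hom Y B) :
  cokl_comp (cokl_proj1 A B) (cokl_pair f g) = g.
Proof. by rewrite cokl_projE; apply: proj1_pair. Qed.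

Lemma cokl_pair_unique Y A B (f : cokl_hom Y A) (g : cokl_hom Y B)
    (h : cokl_hom Y (A × B)) :
  cokl_comp (cokl_proj0 A B) h = f -> cokl_comp (cokl_proj1 A B) h = g ->
  h = cokl_pair f g.
Proof. by rewrite !cokl_projE; apply: pair_unique. Qed.

Definition cokl_products : FiniteProducts coKleisli :=
  @Build_FiniteProducts coKleisli (top : X) (fun A => to_top (T A))
    (fun A (f : cokl_hom A top) => to_top_unique f)
    (fun A B : X => A × B) cokl_proj0 cokl_proj1 cokl_pair
    cokl_proj0_pair cokl_proj1_pair cokl_pair_unique.

Definition cokl_add (A B : X) (f g : cokl_hom A B) : cokl_hom A B :=
  (f : Hom (T A) B) + g.
Definition cokl_zero (A B : X) : cokl_hom A B := (0 : Hom (T A) B).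

Lemma cokl_add_compl A B B' (f g : cokl_hom B B') (x : cokl_hom A B) :
  cokl_comp (cokl_add f g) x = cokl_add (cokl_comp f x) (cokl_comp g x).
Proof. by rewrite /cokl_comp /cokl_add !madd_compl. Qed.

Lemma cokl_zero_compl A B B' (x : cokl_hom A B) :
  cokl_comp (cokl_zero B B') x = cokl_zero A B'.
Proof. by rewrite /cokl_comp /cokl_zero !mzero_compl. Qed.

Definition cokl_left_additive : LeftAdditive coKleisli :=
  @Build_LeftAdditive coKleisli cokl_add cokl_zero
    (fun A B => @maddA X _ (T A) B) (fun A B => @maddC X _ (T A) B)
    (fun A B => @madd0 X _ (T A) B) cokl_add_compl cokl_zero_compl.

Lemma cokl_additive (A B : X) (p : Hom A B) :
  additive _ p ->
  @additive coKleisli cokl_left_additive A B (p ∘ epsilon T A : cokl_hom A B).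
Proof.
move=> [pD p0]; split=> [Y x y|Y] /=; rewrite !cokl_projE.
  exact: pD.
exact: p0.
Qed.

#[global] Instance cokl_cla : CartesianLeftAdditive coKleisli :=
  @Build_CartesianLeftAdditive coKleisli cokl_products cokl_left_additive
    (fun A B : X => cokl_additive (proj0_additive A B))
    (fun A B : X => cokl_additive (proj1_additive A B)).

End CoKleisliCLA.
End CoKleisli.

Arguments cokl_phi {X} T A.
Notation "⟦ f ⟧" := (bracket f) : cat_scope.

Record differential_combinator_transformation (X : category)
    {H : FiniteBiproducts X} (T : comonad X) :=
  DifferentialCombinatorTransformation {
  partial : forall A : X, Hom (T (A × A)) (T A);
  partial_natural : forall A B (f : Hom A B),
    partial B ∘ fmap T (f ⨉ f) = fmap T f ∘ partial A;
  dc1 : forall A : X, partial A ∘ fmap T ι0 = 0;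
  dc2 : forall A : X,
    partial A ∘ fmap T (idm A ⨉ ∇ A) =
    partial A ∘ (fmap T (idm A ⨉ π0) + fmap T (idm A ⨉ π1));
  dc3 : forall A : X, epsilon T A ∘ partial A = π1 ∘ epsilon T (A × A);
  dc4 : forall A : X,
    delta T A ∘ partial A =
    partial (T A) ∘ fmap T ⟨fmap T π0, partial A⟩ ∘ delta T (A × A);
  dc5 : forall A : X,
    partial A ∘ partial (A × A) ∘ fmap T (ell A) = partial A;
  dc6 : forall A : X,
    partial A ∘ partial (A × A) ∘ fmap T (interchange A) =
    partial A ∘ partial (A × A)
}.
Arguments partial {X H T} d A : rename.

Record cartesian_differential_comonad (X : category) {H : FiniteBiproducts X} :=
  CartesianDifferentialComonad {
  cdc_comonad :> comonad X;
  cdc_transformation :> differential_combinator_transformation cdc_comonad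
}.
Arguments cartesian_differential_comonad X {H}.

(* Main.v *)
Require Import Defs.
From Stdlib Require Import ssreflect ProofIrrelevance.
Local Open Scope cat_scope.
Set Implicit Arguments.
Unset Strict Implicit.
Unset Printing Implicit Defensive.

(** Write [D f] for [f ∘ ∂].  The point is that every structural map of the
    coKleisli category (projections, injections, codiagonal, [ell],
    [interchange]) is the image [h ∘ ε] of the same map [h] of the base
    category ([cokl_ell], [cokl_interchange], [cokl_codiag], ...), and that
    composing with such an image is easy on either side: a coKleisli map [g]
    after [h ∘ ε] is [g ∘ !h] ([cokl_comp_base]), and [h ∘ ε] after [g] is
    [h ∘ g] ([cokl_projE]).  Through these two rules, [CD.2], [CD.3], [CD.6]
    and [CD.7] for [D] become [dc.1]-[dc.3], [dc.5] and [dc.6] composed with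
    [f] on the left; for [CD.2] one also needs that [f] is additive, as is every
    map of a category with biproducts.  [CD.1] and [CD.4] only say that sums
    and pairings are preserved by precomposition with [∂].  The chain rule
    [CD.5] is the one axiom that involves a genuine coKleisli composite; it is
    [dc.4], after naturality has moved [∂] past [!f] ([cokl_chain_rule]).

    For (ii), precomposing [D f = f ∘ π1] with [ι1] gives [D f ∘ ι1 = f]; the
    converse holds in any Cartesian differential category
    ([Dlinear_iff_diff_inj1]).  If [f = D f ∘ ι1], differentiating once more
    gives [D f (a, b) = D (D f) ((0, a), (0, b))], which by symmetry of second
    derivatives is [D (D f) ((0, 0), (a, b))].  Additivity splits this into the
    contribution of [(a, 0)], which vanishes, again by symmetry, and that of
    [(0, b)], which is [D f (0, b) = f b].

    The remaining claims follow: [D] applied to an identity of [!A] is [∂],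
    [h ∘ ε] is D-linear by [dc.3], and so the canonical functor factors through
    the D-linear maps. *)

(** * Pairing in Cartesian left additive categories *)

Section Pairing.
Context (C : category) {P : FiniteProducts C}.

Lemma pair_compl (X Y A B : C) (f : Hom X A) (g : Hom X B) (x : Hom Y X) :
  ⟨f, g⟩ ∘ x = ⟨f ∘ x, g ∘ x⟩.
Proof. by apply: pair_unique; rewrite compA ?proj0_pair ?proj1_pair. Qed.

Lemma map_pair (X A B A' B' : C) (h : Hom A A') (k : Hom B B')
    (f : Hom X A) (g : Hom X B) :
  (h ⨉ k) ∘ ⟨f, g⟩ = ⟨h ∘ f, k ∘ g⟩.
Proof. by rewrite pair_compl -!compA proj0_pair proj1_pair. Qed.

End Pairing.

Section AdditivePairing.
Context (C : category) {L : CartesianLeftAdditive C}.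

Lemma maddr0 (A B : C) (f : Hom A B) : f + 0 = f.
Proof. by rewrite maddC madd0. Qed.

Lemma zero_pair (X A B : C) : (0 : Hom X (A × B)) = ⟨0, 0⟩.
Proof.
apply: pair_unique.
  exact: (proj2 (proj0_additive A B)).
exact: (proj2 (proj1_additive A B)).
Qed.

Lemma add_pair (X A B : C) (f f' : Hom X A) (g g' : Hom X B) :
  ⟨f, g⟩ + ⟨f', g'⟩ = ⟨f + f', g + g'⟩.
Proof.
apply: pair_unique.
  by rewrite (proj1 (proj0_additive A B)) !proj0_pair.
by rewrite (proj1 (proj1_additive A B)) !proj1_pair.
Qed.

Lemma codiag_pair (X A : C) (u v : Hom X A) : ∇ A ∘ ⟨u, v⟩ = u + v.
Proof. by rewrite /codiag madd_compl proj0_pair proj1_pair. Qed.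

Lemma interchange_pair (X A : C) (a b c d : Hom X A) :
  interchange A ∘ ⟨⟨a, b⟩, ⟨c, d⟩⟩ = ⟨⟨a, c⟩, ⟨b, d⟩⟩.
Proof. by rewrite /interchange pair_compl !map_pair !proj0_pair !proj1_pair. Qed.

Lemma inj0_comp (X A B : C) (x : Hom X A) : (ι0 : Hom A (A × B)) ∘ x = ⟨x, 0⟩.
Proof. by rewrite /inj0 pair_compl comp1m mzero_compl. Qed.

Lemma inj1_comp (X A B : C) (x : Hom X B) : (ι1 : Hom B (A × B)) ∘ x = ⟨0, x⟩.
Proof. by rewrite /inj1 pair_compl comp1m mzero_compl. Qed.

Lemma ell_pair (X A : C) (a b : Hom X A) : ell A ∘ ⟨a, b⟩ = ⟨⟨a, 0⟩, ⟨0, b⟩⟩.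
Proof. by rewrite /ell map_pair inj0_comp inj1_comp. Qed.

End AdditivePairing.

(** * Linearity in Cartesian differential categories *)

Section LinearMaps.
Context (C : category) {L : CartesianLeftAdditive C}.
Variable D : differential_combinator C.

(** [CD.2] speaks of the maps [1 × ∇], [1 × π0], [1 × π1]; on generalized
    elements it is additivity in the second argument. *)
Lemma diff_addr (X A B : C) (f : Hom A B) (x u v : Hom X A) :
  diff D f ∘ ⟨x, u + v⟩ = diff D f ∘ ⟨x, u⟩ + diff D f ∘ ⟨x, v⟩.
Proof.
have E := f_equal (fun h => h ∘ ⟨x, ⟨u, v⟩⟩) (CD2_add D f).
move: E; rewrite madd_compl -!compA !map_pair codiag_pair.
by rewrite proj0_pair proj1_pair comp1m.
Qed.

Lemma diff_zeror (X A B : C) (f : Hom A B) (x : Hom X A) : diff D f ∘ ⟨x, 0⟩ = 0.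
Proof. by rewrite -inj0_comp compA CD2_zero mzero_compl. Qed.

Lemma Dlinear_inj1 (A B : C) : Dlinear D (ι1 : Hom B (A × B)).
Proof. by rewrite /Dlinear inj1_comp /inj1 CD4 CD1_zero CD3_id. Qed.

(** Differentiating [f = D f ∘ ι1] writes [D f] as a second derivative; symmetry
    then moves the base point of [D f] into a direction argument, where
    additivity can separate it off. *)
Lemma Dlinear_iff_diff_inj1 (A B : C) (f : Hom A B) :
  Dlinear D f <-> diff D f ∘ ι1 = f.
Proof.
split=> [->|fE].
  by rewrite /inj1 -compA proj1_pair compm1.
rewrite /Dlinear -{1}fE CD5 Dlinear_inj1.
rewrite !inj1_comp -(CD7 D f) -compA interchange_pair -zero_pair.
have -> : ⟨π0, π1⟩ = ⟨π0, 0⟩ + ⟨0, π1⟩ :> Hom (A × A) (A × A).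
  by rewrite add_pair madd0 maddr0.
rewrite diff_addr zero_pair.
(* Symmetry turns the direction (a, 0) at (0, 0) into the direction (0, 0)
   at (0, a). *)
rewrite -{1}(CD7 D f) -compA interchange_pair -zero_pair diff_zeror madd0.
by rewrite zero_pair -ell_pair compA CD6 -inj1_comp compA fE.
Qed.

End LinearMaps.

(** * Structural maps of the coKleisli category *)

Section CoKleisliStructure.
Context (X : category) (T : comonad X) {L : CartesianLeftAdditive X}.

(** The action of the canonical functor on maps, with a head symbol of its own:
    unfolded, [h ∘ ε] would be indistinguishable from any other composite of the
    base category when rewriting. *)
Definition base (A B : X) (h : Hom A B) : @Hom (coKleisli T) A B :=
  h ∘ epsilon T A.

Lemma cokl_comp_base (A B B' : X) (g : @Hom (coKleisli T) B B')
    (h : Hom A B) : g ∘ base h = ⟦g⟧ ∘ fmap T h.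
Proof.
rewrite /base /= /cokl_comp (is_functorM (functor_laws T)) -!compA.
by rewrite fmap_epsilon_delta compm1.
Qed.

Lemma base_comp (A B B' : X) (h : Hom B B') (k : Hom A B) :
  base h ∘ base k = base (h ∘ k).
Proof. by rewrite /base /= cokl_projE compA. Qed.

Lemma base_pair (A B B' : X) (h : Hom A B) (k : Hom A B') :
  ⟨base h, base k⟩ = base ⟨h, k⟩.
Proof. by rewrite /base pair_compl. Qed.

Lemma base_id (A : X) : idm (A : coKleisli T) = base (idm A).
Proof. by rewrite /base comp1m. Qed.

Lemma base_zero (A B : X) : (0 : @Hom (coKleisli T) A B) = base 0.
Proof. by rewrite /base mzero_compl. Qed.

Lemma base_proj0 (A B : coKleisli T) :
  (π0 : Hom (A × B) A) = base (π0 : @Hom X _ _).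
Proof. by []. Qed.

Lemma base_proj1 (A B : coKleisli T) :
  (π1 : Hom (A × B) B) = base (π1 : @Hom X _ _).
Proof. by []. Qed.

Lemma cokl_inj0 (A B : coKleisli T) :
  (ι0 : Hom A (A × B)) = base (ι0 : @Hom X _ _).
Proof. by rewrite /inj0 base_id base_zero base_pair. Qed.

Lemma cokl_inj1 (A B : coKleisli T) :
  (ι1 : Hom B (A × B)) = base (ι1 : @Hom X _ _).
Proof. by rewrite /inj1 base_id base_zero base_pair. Qed.

Lemma base_map (A B A' B' : coKleisli T) (h : @Hom X A A') (k : @Hom X B B') :
  (base h ⨉ base k : Hom (A × B) (A' × B')) = base (h ⨉ k).
Proof. by rewrite base_proj0 base_proj1 !base_comp base_pair. Qed.

Lemma cokl_codiag (A : X) : ∇ (A : coKleisli T) = base (∇ A).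
Proof. by rewrite /codiag /base madd_compl. Qed.

Lemma cokl_ell (A : X) : ell (A : coKleisli T) = base (ell A).
Proof. by rewrite /ell cokl_inj0 cokl_inj1 base_map. Qed.

Lemma cokl_interchange (A : X) :
  interchange (A : coKleisli T) = base (interchange A).
Proof. by rewrite /interchange base_proj0 base_proj1 !base_map base_pair. Qed.

End CoKleisliStructure.

(** * The differential combinator of a Cartesian differential comonad *)

Section CoKleisliDifferential.
Context (X : category) {H : FiniteBiproducts X}.
Variable T : cartesian_differential_comonad X.

Definition cokl_diff (A B : coKleisli T) (f : Hom A B) : Hom (A × A) B :=
  ⟦f⟧ ∘ partial T A.

Lemma cokl_diff_comp_base (A B : coKleisli T) (f : Hom A B) (Y : X)
    (h : @Hom X Y (A × A)) :
  cokl_diff f ∘ base T h = ⟦f⟧ ∘ (partial T A ∘ fmap T h).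
Proof. by rewrite cokl_comp_base /cokl_diff /bracket compA. Qed.

Lemma cokl_diff2_comp_base (A B : coKleisli T) (f : Hom A B) (Y : X)
    (h : @Hom X Y ((A × A) × (A × A))) :
  cokl_diff (cokl_diff f) ∘ base T h =
  ⟦f⟧ ∘ (partial T A ∘ partial T (A × A) ∘ fmap T h).
Proof. by rewrite cokl_diff_comp_base /cokl_diff /bracket !compA. Qed.

Lemma cokl_diff_codiag (A B : coKleisli T) (f : Hom A B) :
  cokl_diff f ∘ (idm A ⨉ ∇ A) =
  cokl_diff f ∘ (idm A ⨉ π0) + cokl_diff f ∘ (idm A ⨉ π1).
Proof.
rewrite base_id cokl_codiag (base_proj0 A A) (base_proj1 A A) !base_map.
rewrite !cokl_diff_comp_base dc2.
by rewrite (proj1 (bip_additive (partial T A))) (proj1 (bip_additive ⟦f⟧)).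
Qed.

Lemma cokl_diff_inj0 (A B : coKleisli T) (f : Hom A B) :
  cokl_diff f ∘ ι0 = 0.
Proof.
rewrite cokl_inj0 cokl_diff_comp_base dc1.
exact: (proj2 (bip_additive ⟦f⟧)).
Qed.

Lemma cokl_diff_base (A B : X) (h : Hom A B) :
  cokl_diff (base T h) = (base T h : @Hom (coKleisli T) A B) ∘ π1.
Proof.
rewrite base_proj1 base_comp /cokl_diff /bracket /base.
by rewrite -!compA dc3.
Qed.

(** Naturality of [∂] at [f] turns [g ∘ !f ∘ ∂] into [g ∘ ∂ ∘ !(f ⨉ f)], so that
    [dc.4], which commutes [δ] with [∂], produces the pair
    [⟨f ∘ !π0, f ∘ ∂⟩] under [!]. *)
Lemma cokl_chain_rule (A B B' : coKleisli T) (g : Hom B B') (f : Hom A B) :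
  cokl_diff (g ∘ f) = cokl_diff g ∘ ⟨f ∘ π0, cokl_diff f⟩.
Proof.
rewrite base_proj0 cokl_comp_base /cokl_diff /bracket /= /cokl_comp.
rewrite -!compA dc4 -!compA; congr (_ ∘ _).
rewrite !compA -partial_natural -!compA; congr (_ ∘ _).
rewrite !compA -(is_functorM (functor_laws T)).
by rewrite map_pair.
Qed.

Definition cokl_differential : differential_combinator (coKleisli T).
Proof.
refine (@DifferentialCombinator _ _ cokl_diff _ _ _ _ _ _ _ _ _ _ _).
- by move=> A B f g; apply: (@madd_compl X).
- by move=> A B; apply: (@mzero_compl X).
- exact: cokl_diff_codiag.
- exact: cokl_diff_inj0.
- by move=> A; rewrite base_id cokl_diff_base -base_id comp1m.
- by move=> A B; rewrite (base_proj0 A B) cokl_diff_base.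
- by move=> A B; rewrite (base_proj1 A B) cokl_diff_base.
- by move=> Y A B f g; apply: (@pair_compl X).
- exact: cokl_chain_rule.
- by move=> A B f; rewrite cokl_ell cokl_diff2_comp_base dc5.
- move=> A B f; rewrite cokl_interchange cokl_diff2_comp_base dc6.
  by rewrite /cokl_diff /bracket compA.
Defined.

Lemma Dlinear_base (A B : X) (h : Hom A B) :
  Dlinear cokl_differential (base T h : @Hom (coKleisli T) A B).
Proof. exact: cokl_diff_base. Qed.

Lemma Dlinear_cokl_iff (A B : coKleisli T) (f : Hom A B) :
  Dlinear cokl_differential f <-> ⟦f⟧ ∘ partial T A ∘ fmap T ι1 = ⟦f⟧.
Proof.
have := Dlinear_iff_diff_inj1 cokl_differential f.
by rewrite cokl_inj1 cokl_comp_base.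
Qed.

Definition Dlin_base (A B : X) (h : Hom A B) :
  @Hom (Dlin cokl_differential) A B := exist _ (base T h) (Dlinear_base h).

Lemma Dlin_base_functor :
  @is_functor X (Dlin cokl_differential) (fun A => A) Dlin_base.
Proof.
split=> [A|A B B' g f]; apply: Dlin_hom_eq.
  exact: (is_functor1 (functor_laws (cokl_functor T))).
exact: (is_functorM (functor_laws (cokl_functor T))).
Qed.

(** The two functors have the same action on objects and maps by computation;
    they differ only in their proofs of functoriality. *)
Lemma Dlin_forget_base :
  functor_comp (Dlin_forget cokl_differential) (Functor Dlin_base_functor) =
  cokl_functor T.
Proof. by congr Functor; apply: proof_irrelevance. Qed.

End CoKleisliDifferential.

Theorem theorem3p5 (X : category) (H : FiniteBiproducts X)
    (T : cartesian_differential_comonad X) :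
  exists D : differential_combinator (coKleisli T),
    (forall (A B : coKleisli T) (f : Hom A B),
        ⟦diff D f⟧ = ⟦f⟧ ∘ partial T A)
    /\ (forall A : X, ⟦diff D (cokl_phi T A)⟧ = partial T A)
    /\ (forall (A B : coKleisli T) (f : Hom A B),
        Dlinear D f <-> ⟦f⟧ ∘ partial T A ∘ fmap T ι1 = ⟦f⟧)
    /\ (forall (A B : X) (f : Hom A B), Dlinear D (fmap (cokl_functor T) f))
    /\ (exists (Fm : forall A B : X, Hom A B -> @Hom (Dlin D) A B)
               (HF : @is_functor X (Dlin D) (fun A => A) Fm),
          (forall (A B : X) (f : Hom A B),
              ⟦fmap (Dlin_forget D) (Fm A B f)⟧ = f ∘ epsilon T A
              /\ f ∘ epsilon T A = ⟦fmap (cokl_functor T) f⟧)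
          /\ functor_comp (Dlin_forget D) (Functor HF) = cokl_functor T).
Proof.
exists (cokl_differential T); split; first by [].
split; first by move=> A; apply: comp1m.
split; first exact: Dlinear_cokl_iff.
split; first exact: Dlinear_base.
exists (@Dlin_base X H T), (Dlin_base_functor T).
by split; [split | apply: Dlin_forget_base].
Qed.
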